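(* The discrete flow $\Psi_h$ of the two-step symmetric method M1 (defined in the context) for the relativistic charged-particle system $$\frac{dx}{d\tau}=v,\qquad \frac{dt}{d\tau}=w,\qquad \frac{dv}{d\tau}=v\times B(x)-i\,w\,E(x),\qquad \frac{dw}{d\tau}=i\,E(x)\cdot v$$ preserves the phase-space volume: for every bounded open set $\Omega\subset\mathbb{R}^8$, $$\operatorname{vol}(\Psi_h(\Omega))=\operatorname{vol}(\Omega).$$
   Context: **System.** $A:\mathbb{R}^3\to\mathbb{R}^3$ and $U:\mathbb{R}^3\to\mathbb{R}$ are smooth, $B=\nabla\times A$, $E=-\nabla U$. The unknowns are $x,v\in\mathbb{R}^3$ and purely imaginary scalars $t=i\bar t$, $w=i\gamma$ with $\bar t,\gamma\in\mathbb{R}$. The phase-space variable is $(x,t,v,w)$; phase space is identified with $\mathbb{R}^8$ through the real coordinates $(x,\bar t,v,\gamma)$, and $\operatorname{vol}$ is Lebesgue measure on $\mathbb{R}^8$. **Discrete flow of M1.** Let $\tilde B(x)$ be the skew-symmetric $3\times3$ matrix with $\tilde B(x)\alpha=\alpha\times B(x)$ for all $\alpha\in\mathbb{R}^3$, and $${\bm F}(x)=\begin{pmatrix}\tilde B(x)&-iE(x)\\ iE(x)^{\intercal}&0\end{pmatrix}\in\mathbb{C}^{4\times4}.$$ M1 is the two-step form of the Strang splitting scheme $\Psi_h=\Psi^1_{h/2}\circ\Psi^2_h\circ\Psi^1_{h/2}$, where $\Psi^1_h$ maps $(x;t)\mapsto(x;t)$, $(v;w)\mapsto e^{h{\bm F}(x)}(v;w)$,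 and $\Psi^2_h$ maps $(x;t)\mapsto(x;t)+h(v;w)$, $(v;w)\mapsto(v;w)$. Explicitly, $\Psi_h:(x_n,t_n,v_n,w_n)\mapsto(x_{n+1},t_{n+1},v_{n+1},w_{n+1})$ with $$(x_{n+1};t_{n+1})=(x_n;t_n)+h\,e^{\frac h2{\bm F}(x_n)}(v_n;w_n),\qquad (v_{n+1};w_{n+1})=e^{\frac h2{\bm F}(x_{n+1})}e^{\frac h2{\bm F}(x_n)}(v_n;w_n),$$ where $h$ is the step size. (In the real coordinates $(v,\gamma)$, ${\bm F}(x)$ acts as the real matrix $\begin{pmatrix}\tilde B(x)&E(x)\\ E(x)^{\intercal}&0\end{pmatrix}$, so $\Psi_h$ is a map $\mathbb{R}^8\to\mathbb{R}^8$.) *)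

(* Defs.v *)
From HB Require Import structures.
From mathcomp Require Export all_boot all_order all_algebra.
From mathcomp Require Export complex.
From mathcomp Require Import ring.
From mathcomp Require Export all_classical all_reals all_analysis.

Set Implicit Arguments.
Unset Strict Implicit.
Unset Printing Implicit Defensive.

Import Order.TTheory GRing.Theory Num.Theory.
Export numFieldNormedType.Exports.

Local Open Scope classical_set_scope.
Local Open Scope ring_scope.

Lemma ord3P (k : 'I_3) : [\/ k = inord 0, k = inord 1 | k = inord 2].
Proof.
case: k => [[|[|[|//]]] hk]; [constructor 1|constructor 2|constructor 3];
  by apply: val_inj; rewrite /= inordK.
Qed.

Lemma eq_inord3 (m n : nat) : (m < 3)%N -> (n < 3)%N ->
  ((inord m : 'I_3) == inord n) = (m == n).
Proof. by move=> hm hn; rewrite -val_eqE /= !inordK. Qed.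

Section Calculus.
Context {R : realType}.

Definition partial (n : nat) (W : normedModType R) (i : 'I_n)
  (f : 'cV[R]_n -> W) : 'cV[R]_n -> W := fun x => 'D_(delta_mx i 0) f x.

Definition iter_partial (n : nat) (W : normedModType R) (s : seq 'I_n)
  (f : 'cV[R]_n -> W) : 'cV[R]_n -> W := foldr (@partial n W) f s.

Definition smooth (n : nat) (W : normedModType R) (f : 'cV[R]_n -> W) : Prop :=
  forall s : seq 'I_n, continuous (iter_partial s f) /\
    forall (i : 'I_n) (x : 'cV[R]_n), derivable (iter_partial s f) x (delta_mx i 0).

Definition vec3 (a b c : R) : 'cV[R]_3 := \col_(i < 3) [:: a; b; c]`_i.

Definition crossmul (a b : 'cV[R]_3) : 'cV[R]_3 :=
  let a_ k := a (inord k) 0 in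
  let b_ k := b (inord k) 0 in
  vec3 (a_ 1%N * b_ 2%N - a_ 2%N * b_ 1%N)
       (a_ 2%N * b_ 0%N - a_ 0%N * b_ 2%N)
       (a_ 0%N * b_ 1%N - a_ 1%N * b_ 0%N).

Definition curl (A : 'cV[R]_3 -> 'cV[R]_3) (x : 'cV[R]_3) : 'cV[R]_3 :=
  let d j k := partial (inord j) (fun y => A y (inord k) 0) x in
  vec3 (d 1%N 2%N - d 2%N 1%N) (d 2%N 0%N - d 0%N 2%N) (d 0%N 1%N - d 1%N 0%N).

Definition grad (U : 'cV[R]_3 -> R) (x : 'cV[R]_3) : 'cV[R]_3 :=
  \col_(i < 3) partial i U x.

End Calculus.

Definition expmx {K : numFieldType} {n : nat} (M : 'M[K]_n.+1) : 'M[K]_n.+1 :=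
  limn (series (fun k : nat => k`!%:R^-1 *: M ^+ k)).

Section M1.
Context {R : realType}.
Variables (A : 'cV[R]_3 -> 'cV[R]_3) (U : 'cV[R]_3 -> R).

Definition magnetic (x : 'cV[R]_3) : 'cV[R]_3 := curl A x.
Definition electric (x : 'cV[R]_3) : 'cV[R]_3 := - grad U x.

Definition Btilde (x : 'cV[R]_3) : 'M[R]_3 :=
  \matrix_(i < 3, j < 3) crossmul (delta_mx j 0) (magnetic x) i 0.

Lemma Btilde_mul (x a : 'cV[R]_3) : Btilde x *m a = crossmul a (magnetic x).
Proof.
set B := magnetic x.
have e0 : (ord0 : 'I_3) = inord 0 by apply: val_inj; rewrite /= inordK.
have e1 : (lift ord0 ord0 : 'I_3) = inord 1 by apply: val_inj; rewrite /= inordK.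
have e2 : (lift ord0 (lift ord0 ord0) : 'I_3) = inord 2.
  by apply: val_inj; rewrite /= inordK.
apply/colP => i; rewrite mxE !big_ord_recl big_ord0 e2 e1 e0 !mxE.
case: (ord3P i) => ->; rewrite !inordK //= !eq_inord3 //=; ring.
Qed.

Lemma Btilde_skew (x : 'cV[R]_3) : (Btilde x)^T = - Btilde x.
Proof.
apply/matrixP => i j; rewrite !mxE.
by case: (ord3P i) => ->; case: (ord3P j) => ->; rewrite !inordK //= !eq_inord3 //=; ring.
Qed.

Definition cplx {m n : nat} : 'M[R]_(m, n) -> 'M[R[i]]_(m, n) :=
  map_mx (real_complex R).

Definition force (x : 'cV[R]_3) : 'M[R[i]]_(3 + 1) :=
  block_mx (cplx (Btilde x))               (- 'i%C *: cplx (electric x))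
           ('i%C *: (cplx (electric x))^T) 0.

Lemma force_mul (x v : 'cV[R]_3) (w : R[i]) :
  force x *m col_mx (cplx v) w%:M =
  col_mx (cplx (crossmul v (magnetic x)) - ('i%C * w) *: cplx (electric x))
         ('i%C *: cplx ((electric x)^T *m v)).
Proof.
rewrite /force mul_block_col mul0mx addr0 -Btilde_mul /cplx !map_mxM map_trmx.
by rewrite mul_mx_scalar scalerA -scalemxAl mulrN scaleNr mulrC.
Qed.

(* A state is the pair of columns (x; t) and (v; w). Points with nonreal x occur
   in this type but not in the phase space (the range of [complex_coords]), so
   that the real part taken in [space] is harmless there. *)
Definition state : Type := ('cV[R[i]]_(3 + 1) * 'cV[R[i]]_(3 + 1))%type.

Definition space (s : state) : 'cV[R]_3 := map_mx (@complex.Re R) (usubmx s.1).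

Definition Psi1 (h : R) (s : state) : state :=
  (s.1, expmx (h%:C%C *: force (space s)) *m s.2).

Definition Psi2 (h : R) (s : state) : state := (s.1 + h%:C%C *: s.2, s.2).

Definition Psi (h : R) : state -> state :=
  Psi1 (h / 2) \o Psi2 h \o Psi1 (h / 2).

Lemma Psi_explicit (h : R) (s : state) :
  let e s := expmx ((h / 2)%:C%C *: force (space s)) in
  (Psi h s).1 = s.1 + h%:C%C *: (e s *m s.2) /\
  (Psi h s).2 = e (Psi h s) *m (e s *m s.2).
Proof. by []. Qed.

End M1.

Notation R8 R := (R * R * R * R * R * R * R * R)%type.

Section PhaseSpace.
Context {R : realType}.

(* Identifies R^8 with the phase space: t = i tbar and w = i gamma. A set S of
   states has volume vol (complex_coords @^-1` S). *)
Definition complex_coords (z : R8 R) : state :=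
  let: (x1, x2, x3, tbar, v1, v2, v3, gamma) := z in
  (col_mx (cplx (vec3 x1 x2 x3)) ('i%C * tbar%:C%C)%:M,
   col_mx (cplx (vec3 v1 v2 v3)) ('i%C * gamma%:C%C)%:M).

(* The iterated product is meaningful on Borel sets only. *)
Definition vol : set (R8 R) -> \bar R :=
  let mu := @lebesgue_measure R in
  (mu \x mu \x mu \x mu \x mu \x mu \x mu \x mu)%E.

End PhaseSpace.

(* Main.v *)
From HB Require Import structures.
From mathcomp Require Import ring measurable_realfun.
Require Import Defs.

Set Implicit Arguments.
Unset Strict Implicit.
Unset Printing Implicit Defensive.

Import Order.TTheory GRing.Theory Num.Theory.
Import numFieldNormedType.Exports.

Local Open Scope classical_set_scope.
Local Open Scope ring_scope.

(** In the real coordinates (x, tbar; v, gamma) the scheme is a composition of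
two kinds of maps of R^4 * R^4: the kicks (p, q) |-> (p, M(p) q), where M(p) is
the exponential of a multiple of the real force matrix at the position p, and
the drifts (p, q) |-> (p + h q, q).  By Tonelli's theorem a map that fixes one
of the two blocks and preserves volume in the other one preserves volume.  For a
drift the map in the moving block is a translation, so the only thing to check
is that det M(p) = 1 and that a linear map of determinant 1 preserves volume.

The determinant is obtained without Jacobi's formula.  The force matrix F is
complex skew-symmetric; in real coordinates this says G^T = J (- G) J with J =
diag(1, 1, 1, -1) ([real_force_tr]).  Hence det (exp G) = det (exp (- G)), so
det (exp G) squares to 1; applied to G / 2, whose exponential squares to exp G,
this gives det (exp G) = 1 ([det_expmx_skew]).  The addition formula
exp (A + B) = exp A exp B for commuting matrices ([expmxD]) also yields the
inverse of a kick.

A matrix of determinant 1 is a product of transvections ([transvection_ind]),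
and a transvection of R^4 is, up to a cyclic permutation of the coordinates, a
shear (y, s) |-> (y, s + g(y)) of R^3 * R, which preserves volume by Tonelli's
theorem and translation invariance ([mp_lin4]).

The flow with step h is inverted by the flow with step - h, so the image of
Omega under the former is the preimage of Omega under the latter
([Psi_image]).  This reduces the theorem to measure preservation in the sense
of preimages ([mp_flow]), which needs Omega and the flow to be measurable: an
open set is a countable union of rational boxes ([measurable_basis_prod]), and the
entries of the exponential are pointwise limits of polynomials in the fields
([measurable_expmx]). *)

(** * The exponential of a matrix *)

Lemma cvg_mxP (T : Type) (K : numFieldType) (m n : nat) (F : set_system T)
    (FF : Filter F) (u : T -> 'M[K]_(m, n)) (M : 'M[K]_(m, n)) :
  u k @[k --> F] --> M <-> forall i j, u k i j @[k --> F] --> M i j.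
Proof.
split=> [uM i j|uM].
  apply/cvg_ballP => e e0; move/cvg_ballP : uM => /(_ e e0).
  by apply: filterS => k [_].
apply/cvg_ballP => e e0.
have : \forall k \near F, forall i j, ball (M i j) e (u k i j).
  apply: filter_forall => i; apply: filter_forall => j.
  by move/cvg_ballP : (uM i j) => /(_ e e0).
by apply: filterS => k ?; split.
Qed.

Lemma cvg_mulmx (K : numFieldType) (n : nat) (u v : nat -> 'M[K]_n.+1) (A B : 'M[K]_n.+1) :
  u k @[k --> \oo] --> A -> v k @[k --> \oo] --> B ->
  u k * v k @[k --> \oo] --> A * B.
Proof.
move=> /cvg_mxP uA /cvg_mxP vB; apply/cvg_mxP => i j.
under eq_fun do rewrite mxE; rewrite mxE.
apply: cvg_big => [|k _]; first exact: add_continuous.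
by apply: cvgM.
Qed.

Lemma mx_conjX (K : comUnitRingType) (n k : nat) (P Q A : 'M[K]_n.+1) :
  Q * P = 1 -> (P * A * Q) ^+ k = P * A ^+ k * Q.
Proof.
move=> QP; elim: k => [|k IH].
  by rewrite !expr0 mulr1 (mulmx1C QP : P * Q = 1).
rewrite exprS IH exprS !mulrA; congr (_ * _).
by rewrite -(mulrA _ Q P) QP mulr1.
Qed.

Definition exp_sum (K : numFieldType) (V : algType K) (N : nat) (A : V) : V :=
  \sum_(0 <= k < N) k`!%:R^-1 *: A ^+ k.

(** The right-hand side keeps the terms of the product of total degree at least
N. It is a polynomial in A and B with nonnegative coefficients, so that its norm
is bounded, up to constants, by the value of the same polynomial at the norms;
this reduces the addition formula for matrices to the one for real numbers. *)
Lemma exp_sumM (K : numFieldType) (V : algType K) (A B : V) (N : nat) :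
  GRing.comm A B ->
  exp_sum N A * exp_sum N B - exp_sum N (A + B) =
  \sum_(i < N) \sum_(j < N | (N <= i + j)%N)
    (i`!%:R^-1 * j`!%:R^-1) *: (A ^+ i * B ^+ j).
Proof.
move=> cAB.
pose c (i j : nat) := (i`!%:R^-1 * j`!%:R^-1) *: (A ^+ i * B ^+ j).
have -> : exp_sum N A * exp_sum N B = \sum_(i < N) \sum_(j < N) c i j.
  rewrite /exp_sum !big_mkord mulr_suml; apply: eq_bigr => i _.
  rewrite mulr_sumr; apply: eq_bigr => j _.
  by rewrite /c -scalerAl -scalerAr scalerA.
have -> : exp_sum N (A + B) =
    \sum_(i < N) \sum_(j < N | (i + j < N)%N) c i j.
  transitivity (\sum_(k < N) \sum_(i < N | (i <= k)%N) c i (k - i)%N).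
    rewrite /exp_sum big_mkord; apply: eq_bigr => k _.
    rewrite addrC exprDn_comm; last exact/commr_sym.
    rewrite scaler_sumr (big_ord_widen N
      (fun i => k`!%:R^-1 *: (B ^+ (k - i) * A ^+ i *+ 'C(k, i)))) //.
    apply: eq_bigr => i; rewrite ltnS => ik.
    rewrite /c -(scaler_nat 'C(k, i)) scalerA -(bin_fact ik) !natrM.
    rewrite (commrX _ (commr_sym (commrX _ (commr_sym cAB)))).
    congr (_ *: _); field.
    by rewrite !pnatr_eq0 -!lt0n !fact_gt0 bin_gt0 ik.
  rewrite (exchange_big_dep xpredT) //=; apply: eq_bigr => i _.
  rewrite -(big_mkord (fun k => (i <= k)%N) (fun k => c i (k - i)%N)).
  rewrite -(big_mkord (fun j => (i + j < N)%N) (fun j => c i j)).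
  rewrite -(big_nat_widenl _ _ _ xpredT) // -{1}[i : nat]add0n big_addn.
  rewrite (big_nat_widen _ _ N) ?leq_subr //; apply: eq_big => [j|j _].
    by rewrite /= ltn_subRL.
  by rewrite addnK.
rewrite -sumrB; apply: eq_bigr => i _.
rewrite [X in X - _](bigID (fun j : 'I_N => (i + j < N)%N)) /= addrAC subrr add0r.
by apply: eq_bigl => j; rewrite -leqNgt.
Qed.

(** Makes real matrices a complete normed module, which is what absolute
convergence of a series requires. *)
HB.instance Definition _ (R : realType) (m n : nat) :=
  Uniform_isComplete.Build 'M[R]_(m, n) cauchy_cvg.

Section RealExp.
Context {R : realType} {n : nat}.
Implicit Types A B : 'M[R]_n.+1.

(** The norm is the largest absolute value of an entry, which is submultiplicative
only up to the size of the matrices. *)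
Lemma mx_normM_le A B : `|A * B| <= n.+1%:R * `|A| * `|B|.
Proof.
rewrite [leLHS]/Num.Def.normr /= mx_normrE; apply: bigmax_le => [|[i j] _].
  by rewrite !mulr_ge0.
rewrite mxE /= (le_trans (ler_norm_sum _ _ _)) //.
rewrite -mulrA mulr_natl -[X in _ *+ X]card_ord -sumr_const.
apply: ler_sum => k _; rewrite normrM.
have entry (M : 'M[R]_n.+1) a b : `|M a b| <= `|M|.
  rewrite [leRHS]/Num.Def.normr /= mx_normrE.
  exact: (le_bigmax _ (fun ij : 'I_n.+1 * 'I_n.+1 => `|M ij.1 ij.2|) (a, b)).
by apply: ler_pM.
Qed.

Lemma mx_normX_le A k : `|A ^+ k| <= (n.+1%:R * `|A|) ^+ k.
Proof.
elim: k => [|k IH].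
  rewrite !expr0 [leLHS]/Num.Def.normr /= mx_normrE; apply: bigmax_le => // -[i j] _.
  by rewrite mxE /=; case: eqP; rewrite ?normr1 ?normr0.
by rewrite !exprS (le_trans (mx_normM_le _ _)) // ler_wpM2l.
Qed.

(** The regular algebra R^o makes the scalar exponential an instance of the same
partial sums. *)
Lemma exp_sumR (x : R) N : series (exp_coeff x) N = exp_sum N (x : R^o).
Proof.
rewrite seriesEnat /exp_sum /=; apply: eq_bigr => k _.
by rewrite /exp_coeff /= mulrC.
Qed.

Lemma exp_sum_mx A N : series (fun k => k`!%:R^-1 *: A ^+ k) N = exp_sum N A.
Proof. by rewrite seriesEnat. Qed.

Lemma cvg_expmx A : exp_sum N A @[N --> \oo] --> expmx A.
Proof.
rewrite (_ : (fun N => exp_sum N A) = series (fun k => k`!%:R^-1 *: A ^+ k)); last first.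
  by apply/funext => N; rewrite exp_sum_mx.
suff : cvgn (series (fun k => k`!%:R^-1 *: A ^+ k)) by [].
apply: normed_cvg.
apply: (@series_le_cvg _ _ (exp_coeff (n.+1%:R * `|A|))).
- by move=> k /=.
- by move=> k; rewrite exp_coeff_ge0 // mulr_ge0.
- move=> k /=; rewrite normrZ mulrC ger0_norm ?invr_ge0 //.
  by rewrite ler_wpM2r ?invr_ge0 // mx_normX_le.
exact: is_cvg_series_exp_coeff.
Qed.

Lemma expmx_lim A M : exp_sum N A @[N --> \oo] --> M -> expmx A = M.
Proof. by move/(cvg_unique (@norm_hausdorff _ _) (@cvg_expmx A)). Qed.

Lemma expmxD A B : GRing.comm A B -> expmx (A + B) = expmx A * expmx B.
Proof.
move=> cAB.
have lhs : exp_sum N A * exp_sum N B @[N --> \oo] --> expmx A * expmx B.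
  by apply: cvg_mulmx; exact: cvg_expmx.
pose a := n.+1%:R * `|A|; pose b := n.+1%:R * `|B|.
(* the scalar remainder, which dominates the matrix one up to the factor n.+1 *)
pose r N := exp_sum N (a : R^o) * exp_sum N (b : R^o) - exp_sum N (a + b : R^o).
have r0 : r N @[N --> \oo] --> (0 : R).
  rewrite -(subrr (expR (a + b))) {1}expRD /r.
  under eq_fun do rewrite -!exp_sumR.
  by apply: cvgB; [apply: cvgM|]; exact: is_cvg_series_exp_coeff.
have d0 : exp_sum N A * exp_sum N B - exp_sum N (A + B) @[N --> \oo] --> (0 : 'M[R]_n.+1).
  apply/norm_cvg0P.
  apply: (@squeeze_cvgr _ _ _ _ (fun=> 0) (fun N => n.+1%:R * r N)); last 2 first.
  - exact: cvg_cst.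
  - by rewrite -(mulr0 n.+1%:R); apply: cvgM => //; exact: cvg_cst.
  apply: nearW => N; rewrite normr_ge0 /= exp_sumM // /r exp_sumM; last exact: mulrC.
  rewrite (le_trans (ler_norm_sum _ _ _)) // mulr_sumr ler_sum // => i _.
  rewrite (le_trans (ler_norm_sum _ _ _)) // mulr_sumr ler_sum // => j _.
  rewrite normrZ ger0_norm ?mulr_ge0 ?invr_ge0 // mulrCA ler_wpM2l ?mulr_ge0 ?invr_ge0 //.
  rewrite (le_trans (mx_normM_le _ _)) // -mulrA ler_wpM2l // ler_pM // mx_normX_le //.
apply: expmx_lim; rewrite -[X in _ --> X]subr0.
rewrite (_ : (fun N => exp_sum N (A + B)) = (fun N => exp_sum N A * exp_sum N B -
    (exp_sum N A * exp_sum N B - exp_sum N (A + B)))).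
  exact: cvgB lhs d0.
by apply/funext => N; rewrite subKr.
Qed.

Lemma expmx0 : expmx (0 : 'M[R]_n.+1) = 1.
Proof.
apply: expmx_lim.
apply: (@cvg_near_cst _ _ _ _ _ _).
near=> N; rewrite /exp_sum big_ltn; last by near: N; exists 1%N.
rewrite big_nat big1 ?addr0 ?expr0 ?fact0 ?invr1 ?scale1r // => k /andP[k0 _].
by rewrite expr0n gtn_eqF // scaler0.
Unshelve. all: by end_near. Qed.

Lemma expmxNK A : expmx (- A) * expmx A = 1.
Proof.
rewrite -expmxD ?addNr ?expmx0 //.
by apply: commr_sym; apply: commrN.
Qed.

Lemma expmx_tr A : expmx A^T = (expmx A)^T.
Proof.
apply: expmx_lim.
apply/cvg_mxP => i j; rewrite mxE.
rewrite (_ : (fun N => _) = (fun N => exp_sum N A j i)).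
  by have /cvg_mxP := @cvg_expmx A; exact.
apply/funext => N; rewrite /exp_sum !summxE; apply: eq_bigr => k _; rewrite !mxE.
congr (_ * _).
have -> : A^T ^+ k = (A ^+ k)^T.
  elim: k => [|k IH]; first by rewrite !expr0 trmx1.
  by rewrite exprS IH [in RHS]exprSr; apply/esym/trmx_mul.
by rewrite mxE.
Qed.

Lemma expmx_conj (P Q A : 'M[R]_n.+1) : Q * P = 1 ->
  expmx (P * A * Q) = P * expmx A * Q.
Proof.
move=> QP; apply: expmx_lim.
rewrite (_ : (fun N => _) = (fun N => P * exp_sum N A * Q)).
  by apply: cvg_mulmx; [apply: cvg_mulmx; [|exact: cvg_expmx]|]; exact: cvg_cst.
apply/funext => N.
rewrite /exp_sum mulr_sumr mulr_suml; apply: eq_bigr => k _.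
by rewrite mx_conjX // -scalerAr -scalerAl.
Qed.

(** A matrix whose transpose is similar to its opposite has trace 0; the
determinant of its exponential is found by symmetry instead. Transposition and
conjugation leave the determinant alone, so exp A and exp (- A) have the same
one and it squares to 1. The sign is fixed by writing exp A as the square of
exp (A / 2). *)
Lemma det_expmx_skew (P Q A : 'M[R]_n.+1) : Q * P = 1 ->
  A^T = P * - A * Q -> \det (expmx A) = 1.
Proof.
move=> QP skewA.
have sq c : \det (expmx (c *: A)) ^+ 2 = 1.
  have dN : \det (expmx (c *: A)) = \det (expmx (- (c *: A))).
    rewrite -det_tr -expmx_tr.
    have -> : (c *: A)^T = P * - (c *: A) * Q.
      by rewrite linearZ /= skewA -scalerN scalerAl scalerAr.
    rewrite expmx_conj // !detM mulrAC -detM.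
    by rewrite (mulmx1C QP : P * Q = 1) det1 mul1r.
  by rewrite expr2 {1}dN -detM expmxNK det1.
have -> : A = 2^-1 *: A + 2^-1 *: A.
  by rewrite -scalerDl -mulr2n -[_ *+ 2]mulr_natl mulfV ?scale1r // pnatr_eq0.
by rewrite expmxD // detM -expr2 sq.
Qed.

End RealExp.

(** Radii of balls in R[i] are complex numbers; a positive one is real. *)
Lemma real_complex_continuous (R : realType) :
  continuous (real_complex R : R -> (R[i] : numFieldType)).
Proof.
move=> x; apply/cvgrPdist_lt => e e0.
have [eE Re0] : e = (complex.Re e)%:C%C /\ 0 < complex.Re e.
  move: e0; rewrite ltcE /= => /andP[/eqP ime re]; split => //.
  by case: e ime {re} => a b /= ->.
have : \forall y \near x, `|x - y| < complex.Re e by exact: (@nbhsx_ballx _ R x _ Re0).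
apply: filterS => y xy.
by rewrite -rmorphB /= normc_def /= expr0n addr0 sqrtr_sqr eE ltcR.
Qed.

(** The real and the complex exponential are limits for two different
topologies; this lets all computations take place over the reals. *)
Lemma expmx_complex (R : realType) (n : nat) (P Q : 'M[R[i]]_n.+1) (A : 'M[R]_n.+1) :
  Q * P = 1 -> expmx (P * cplx A * Q) = P * cplx (expmx A) * Q.
Proof.
move=> QP; apply: cvg_lim; first exact: norm_hausdorff.
rewrite (_ : series _ = (fun N => P * cplx (exp_sum N A) * Q)).
  apply: cvg_mulmx; [apply: cvg_mulmx|]; [exact: cvg_cst| |exact: cvg_cst].
  apply/cvg_mxP => i j; under eq_fun do rewrite mxE; rewrite mxE.
  apply: (@cvg_comp _ _ _ (fun N => exp_sum N A i j) (real_complex R) _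
    (nbhs (expmx A i j))).
    by have /cvg_mxP := @cvg_expmx _ _ A; exact.
  exact: real_complex_continuous.
apply/funext => N; rewrite seriesEnat /exp_sum /cplx raddf_sum /=.
rewrite mulr_sumr mulr_suml; apply: eq_bigr => k _.
rewrite mx_conjX // map_mxZ /= fmorphV rmorph_nat rmorphXn /=.
by rewrite -scalerAr -scalerAl.
Qed.

(** * Matrices of determinant 1 are products of transvections *)

Section SpecialLinear.
Variable F : fieldType.

Lemma mul_transvection (n m : nat) (i j : 'I_n) (c : F) (M : 'M[F]_(n, m)) :
  (1%:M + c *: delta_mx i j) *m M = M + c *: (delta_mx i 0 *m row j M).
Proof.
rewrite mulmxDl mul1mx -scalemxAl rowE mulmxA; congr (_ + _ *: (_ *m _)).
by rewrite mul_delta_mx.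
Qed.

Lemma mul_transvection_col (n : nat) (i j : 'I_n) (c : F) (u : 'cV[F]_n) :
  (1%:M + c *: delta_mx i j) *m u = u + (c * u j 0) *: delta_mx i 0.
Proof.
rewrite mul_transvection -scalerA; congr (_ + _ *: _).
by rewrite [row j u]mx11_scalar mul_mx_scalar mxE.
Qed.

Lemma transvectionK (n : nat) (i j : 'I_n) (c : F) : i != j ->
  (1%:M + (- c) *: delta_mx i j) *m (1%:M + c *: delta_mx i j) = 1%:M.
Proof.
move=> ij; rewrite mulmxDl mul1mx mulmxDr mulmx1 -scalemxAl -scalemxAr.
rewrite mul_delta_mx_cond eq_sym (negbTE ij) mulr0n !scaler0 addr0 scaleNr.
by rewrite addrK.
Qed.

Lemma det_transvection (n : nat) (i j : 'I_n) (c : F) : i != j ->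
  \det (1%:M + c *: delta_mx i j) = 1.
Proof.
wlog ij : i j / (j < i)%N => [lower|] neq_ij.
  case: (ltngtP j i) => [ji|ij|/val_inj eq_ji]; first exact: lower.
    rewrite -det_tr linearD linearZ /= trmx1 trmx_delta.
    by apply: lower; rewrite // eq_sym.
  by rewrite eq_ji eqxx in neq_ij.
rewrite det_trig => [|]; last first.
  apply/is_trig_mxP => k l kl; rewrite !mxE (ltn_eqF kl : (k == l) = false) add0r.
  case: (k =P i) => [ki|_]; last by rewrite mulr0.
  case: (l =P j) => [lj|_]; last by rewrite mulr0.
  by move: kl; rewrite ki lj ltnNge (ltnW ij).
rewrite big1 // => k _; rewrite !mxE eqxx.
have [->|] := eqVneq k i; last by rewrite mulr0 addr0.
by rewrite (negbTE neq_ij) mulr0 addr0.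
Qed.

(** Gaussian elimination by induction on the size. A row operation brings 1 to
the top left corner, which requires a nonzero entry below the corner and thus
possibly a preliminary row operation to create one. Then the matrix factors as
lower block * diag(1, S) * upper block, where S is the Schur complement. *)
Lemma transvection_ind (n : nat) (P : 'M[F]_n -> Prop) :
  P 1%:M -> (forall A B, P A -> P B -> P (A *m B)) ->
  (forall i j c, i != j -> P (1%:M + c *: delta_mx i j)) ->
  forall M, \det M = 1 -> P M.
Proof.
elim: n P => [|n IH] P P1 PM PT M; first by rewrite (flatmx0 M) -(flatmx0 1%:M).
(* restates PT for the size in the form that block matrices expect *)
have PT' (i j : 'I_(1 + n)) c : i != j -> P (1%:M + c *: delta_mx i j) by exact: PT.
have Pcol (c : 'cV_n) : P (block_mx 1%:M 0 c 1%:M : 'M[F]_(1 + n)).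
  rewrite (matrix_sum_delta c); elim/big_ind : _ => [|a b Pa Pb|i _].
  - by rewrite -scalar_mx_block.
  - have -> : block_mx 1%:M 0 (a + b) 1%:M =
        block_mx 1%:M 0 a 1%:M *m block_mx 1%:M 0 b 1%:M :> 'M[F]_(1 + n).
      by rewrite mulmx_block !(mul1mx, mulmx1, mul0mx, mulmx0, addr0, add0r).
    exact: PM.
  have := PT' (rshift 1 i) (lshift n 0) (c i 0) isT.
  rewrite delta_mx_dshift delta_mx_lshift big_ord1 -[X in col_mx X _]row_mx0.
  rewrite -/(block_mx 0 0 (delta_mx i 0) 0) scale_block_mx scalar_mx_block.
  by rewrite add_block_mx !scaler0 !addr0 add0r.
have Prow (r : 'rV_n) : P (block_mx 1%:M r 0 1%:M : 'M[F]_(1 + n)).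
  rewrite (matrix_sum_delta r) big_ord1; elim/big_ind : _ => [|a b Pa Pb|i _].
  - by rewrite -scalar_mx_block.
  - have -> : block_mx 1%:M (a + b) 0 1%:M =
        block_mx 1%:M b 0 1%:M *m block_mx 1%:M a 0 1%:M :> 'M[F]_(1 + n).
      by rewrite mulmx_block !(mul1mx, mulmx1, mul0mx, mulmx0, addr0, add0r).
    exact: PM.
  have := PT' (lshift n 0) (rshift 1 i) (r 0 i) isT.
  rewrite delta_mx_ushift delta_mx_rshift -[X in col_mx _ X]row_mx0.
  rewrite -/(block_mx 0 (delta_mx 0 i) 0 0) scale_block_mx scalar_mx_block.
  by rewrite add_block_mx !scaler0 !addr0 add0r.
(* with 1 in the corner: factor through the Schur complement *)
have pivot1 (N : 'M[F]_(1 + n)) : N 0 0 = 1 -> \det N = 1 -> P N.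
  move=> N00; have ulN : ulsubmx N = 1%:M.
    apply/matrixP => i j; rewrite !ord1 !mxE /= -[RHS]N00.
    by congr (N _ _); apply: val_inj.
  pose S := drsubmx N - dlsubmx N *m ursubmx N.
  have -> : N = block_mx 1%:M 0 (dlsubmx N) 1%:M *m
      (block_mx 1%:M 0 0 S *m block_mx 1%:M (ursubmx N) 0 1%:M).
    rewrite !mulmx_block !(mul1mx, mulmx1, mul0mx, mulmx0, addr0, add0r).
    by rewrite /S addrC subrK -{1}ulN submxK.
  rewrite det_mulmx det_lblock det_mulmx det_ublock det_ublock !det1 !(mul1r, mulr1).
  move=> detS; apply: (PM _ _ (Pcol _)); apply: (PM _ _ _ (Prow _)).
  apply: (IH (fun S0 : 'M[F]_n => P (block_mx 1%:M 0 0 S0 : 'M[F]_(1 + n))) _ _ _ S) => //.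
  - move=> A B PA PB.
    have -> : block_mx 1%:M 0 0 (A *m B) =
        block_mx 1%:M 0 0 A *m block_mx 1%:M 0 0 B :> 'M[F]_(1 + n).
      by rewrite mulmx_block !(mul1mx, mulmx1, mul0mx, mulmx0, addr0, add0r).
    exact: PM.
  move=> i j c ij; have := PT' (rshift 1 i) (rshift 1 j) c.
  rewrite eq_rshift => /(_ ij).
  rewrite delta_mx_dshift delta_mx_rshift -[X in col_mx X _]row_mx0.
  rewrite -/(block_mx 0 0 0 (delta_mx i j)) scale_block_mx scalar_mx_block.
  by rewrite add_block_mx !scaler0 !addr0.
have step (N : 'M[F]_(1 + n)) i j c : i != j -> P ((1%:M + c *: delta_mx i j) *m N) -> P N.
  move=> ij PN; rewrite -[N]mul1mx -(transvectionK c ij) -mulmxA.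
  by apply: PM => //; exact: PT'.
have det_step (N : 'M[F]_(1 + n)) i j c : i != j ->
    \det ((1%:M + c *: delta_mx i j) *m N) = \det N.
  by move=> ij; rewrite det_mulmx det_transvection // mul1r.
(* a nonzero entry below the corner can be used to produce 1 in the corner *)
have pivot (N : 'M[F]_(1 + n)) i : i != 0 -> N i 0 != 0 -> \det N = 1 -> P N.
  move=> i0 Ni0 detN; have i0' : 0 != i by rewrite eq_sym.
  apply: (step N 0 i ((1 - N 0 0) / N i 0)) => //.
  apply: pivot1; last by rewrite det_step.
  by rewrite mul_transvection !mxE big_ord1 !mxE !eqxx mul1r divfK // addrC subrK.
move=> detM.
have [/existsP[i /andP[i0 Mi0]]|] :=
  boolP [exists i : 'I_(1 + n), (i != 0) && (M i 0 != 0)].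
  exact: pivot i0 Mi0 detM.
rewrite negb_exists => /forallP Mcol.
have {}Mcol i : i != 0 -> M i 0 = 0.
  by move=> i0; have := Mcol i; rewrite i0 /= negbK => /eqP.
(* the first column is now a multiple of the first basis vector *)
have M00 : M 0 0 != 0.
  apply: contra_eq_neq detM => M00.
  rewrite (expand_det_col M 0) big1 ?(eq_sym 0) ?oner_neq0 //.
  by move=> i _; have [->|/Mcol ->] := eqVneq i 0; rewrite ?M00 mul0r.
case: n => [|n] in IH P P1 PM PT PT' M Pcol Prow pivot1 step det_step pivot detM Mcol M00 *.
  by apply: pivot1 => //; rewrite -detM det_mx11.
pose i1 : 'I_(1 + n.+1) := lift 0 0.
apply: (step M i1 0 1) => //.
apply: (pivot _ i1) => //; last by rewrite det_step.
by rewrite mul_transvection !mxE big_ord1 !mxE !eqxx !mul1r Mcol // add0r.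
Qed.

End SpecialLinear.

(** * Maps preserving a measure *)

Section SigmaFiniteProduct.
Context d1 d2 (T1 : measurableType d1) (T2 : measurableType d2) (R : realType).
Variables (m1 : {sigma_finite_measure set T1 -> \bar R})
          (m2 : {sigma_finite_measure set T2 -> \bar R}).

Let prodm : set (T1 * T2) -> \bar R := (m1 \x m2)%E.
HB.instance Definition _ := Measure.on prodm.

Let sigma_finite_prodm : sigma_finite setT prodm.
Proof.
have /sigma_finiteP[F [FT ndF Foo]] := sigma_finiteT m1.
have /sigma_finiteP[G [GT ndG Goo]] := sigma_finiteT m2.
exists (fun n => F n `*` G n) => [|n]; last first.
  have [mF ltF] := Foo n; have [mG ltG] := Goo n; split; first exact: measurableX.
  by rewrite /prodm product_measure1E // lte_mul_pinfty // ge0_fin_numE.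
apply/esym; rewrite -subTset => -[x y] _.
have [n _ Fx] : (\bigcup_n F n) x by rewrite -FT.
have [k _ Gy] : (\bigcup_n G n) y by rewrite -GT.
exists (maxn n k) => //; split.
  exact: (subsetPset _ _ (ndF _ _ (leq_maxl n k))).
exact: (subsetPset _ _ (ndG _ _ (leq_maxr n k))).
Qed.

HB.instance Definition _ := Measure_isSigmaFinite.Build _ _ _ prodm sigma_finite_prodm.

(** The product bundled with its sigma-finiteness, so that products can be
iterated. *)
Definition sfprod : {sigma_finite_measure set (T1 * T2)%type -> \bar R} :=
  [the {sigma_finite_measure set (T1 * T2)%type -> \bar R} of prodm].

End SigmaFiniteProduct.

Definition mpreserving d1 d2 (T1 : measurableType d1) (T2 : measurableType d2)
    (R : realType) (m1 : {sigma_finite_measure set T1 -> \bar R})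
    (m2 : {sigma_finite_measure set T2 -> \bar R}) (f : T1 -> T2) : Prop :=
  measurable_fun setT f /\ forall S, measurable S -> m1 (f @^-1` S) = m2 S.

Section MeasurePreserving.
Context d1 d2 d3 (T1 : measurableType d1) (T2 : measurableType d2)
  (T3 : measurableType d3) (R : realType).

Lemma mp_id (m1 : {sigma_finite_measure set T1 -> \bar R}) : mpreserving m1 m1 id.
Proof. by split. Qed.

Lemma mp_comp (m1 : {sigma_finite_measure set T1 -> \bar R})
    (m2 : {sigma_finite_measure set T2 -> \bar R})
    (m3 : {sigma_finite_measure set T3 -> \bar R})
    (f : T1 -> T2) (g : T2 -> T3) :
  mpreserving m1 m2 f -> mpreserving m2 m3 g -> mpreserving m1 m3 (g \o f).
Proof.
move=> [mf fP] [mg gP]; split; first exact: measurableT_comp.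
move=> S mS; rewrite comp_preimage fP ?gP //.
by rewrite -[X in measurable X]setTI; exact: mg.
Qed.

Lemma mp_inv (m1 : {sigma_finite_measure set T1 -> \bar R})
    (m2 : {sigma_finite_measure set T2 -> \bar R})
    (f : T1 -> T2) (g : T2 -> T1) :
  cancel f g -> measurable_fun setT g ->
  mpreserving m1 m2 f -> mpreserving m2 m1 g.
Proof.
move=> fK mg [mf fP]; split => // S mS.
rewrite -fP; last by rewrite -[X in measurable X]setTI; exact: mg.
by rewrite -comp_preimage (_ : g \o f = id) //; apply/funext.
Qed.

End MeasurePreserving.

Section Products.
Context d1 d2 d3 (T1 : measurableType d1) (T2 : measurableType d2)
  (T3 : measurableType d3) (R : realType).

(** Tonelli's theorem: the fibre of the preimage of S over x is the preimage
under g x of the fibre of S. *)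
Lemma mp_skew (m1 : {sigma_finite_measure set T1 -> \bar R})
    (m2 : {sigma_finite_measure set T2 -> \bar R})
    (m3 : {sigma_finite_measure set T3 -> \bar R})
    (g : T1 -> T2 -> T3) :
  measurable_fun setT (fun z : T1 * T2 => g z.1 z.2) ->
  (forall x, mpreserving m2 m3 (g x)) ->
  mpreserving (sfprod m1 m2) (sfprod m1 m3) (fun z : T1 * T2 => (z.1, g z.1 z.2)).
Proof.
move=> mg gP; split; first exact: measurable_fun_pair.
move=> S mS; apply: eq_integral => x _ /=.
rewrite -(proj2 (gP x)); last exact: measurable_xsection.
by congr (m2 _); apply/seteqP; split => y /=; rewrite /xsection /= !inE.
Qed.

(** Integrating in either order gives the same value on boxes, hence everywhere by
uniqueness of the product measure. *)
Lemma mp_swap (m1 : {sigma_finite_measure set T1 -> \bar R})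
    (m2 : {sigma_finite_measure set T2 -> \bar R}) :
  mpreserving (sfprod m1 m2) (sfprod m2 m1) (fun z : T1 * T2 => (z.2, z.1)).
Proof.
split; first exact: measurable_fun_pair.
move=> S mS; rewrite [RHS](@product_measure_unique _ _ _ _ _ m2 m1 (m2 \x^ m1)%E) //.
by move=> A B mA mB; exact: product_measure2E.
Qed.

Definition assocr (z : T1 * T2 * T3) := (z.1.1, (z.1.2, z.2)).
Definition assocl (z : T1 * (T2 * T3)) := (z.1, z.2.1, z.2.2).

Lemma measurable_assocl : measurable_fun setT assocl.
Proof.
apply: measurable_fun_pair; last exact: measurableT_comp.
by apply: measurable_fun_pair => //; exact: measurableT_comp.
Qed.

(** Both sides are the same triple integral. *)
Lemma mp_assocr (m1 : {sigma_finite_measure set T1 -> \bar R})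
    (m2 : {sigma_finite_measure set T2 -> \bar R})
    (m3 : {sigma_finite_measure set T3 -> \bar R}) :
  mpreserving (sfprod (sfprod m1 m2) m3) (sfprod m1 (sfprod m2 m3)) assocr.
Proof.
have massoc : measurable_fun setT assocr.
  apply: measurable_fun_pair; first exact: measurableT_comp.
  by apply: measurable_fun_pair => //; exact: measurableT_comp.
split=> // S mS.
have mS' : measurable (assocr @^-1` S).
  by rewrite -[X in measurable X]setTI; exact: massoc.
transitivity (\int[m1 \x m2]_z (m3 \o xsection (assocr @^-1` S)) z)%E => //.
rewrite (@fubini_tonelli1 _ _ _ _ _ m1 m2); first last.
- by move=> z; exact: measure_ge0.
- exact: measurable_fun_xsection.
apply: eq_integral => x _ /=.
apply: eq_integral => y _ /=; congr (m3 _).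
by apply/seteqP; split => z /=; rewrite /xsection /= !inE /= !inE.
Qed.

Lemma mp_assocl (m1 : {sigma_finite_measure set T1 -> \bar R})
    (m2 : {sigma_finite_measure set T2 -> \bar R})
    (m3 : {sigma_finite_measure set T3 -> \bar R}) :
  mpreserving (sfprod m1 (sfprod m2 m3)) (sfprod (sfprod m1 m2) m3) assocl.
Proof.
by apply: mp_inv (mp_assocr m1 m2 m3); [case=> -[]|exact: measurable_assocl].
Qed.
End Products.

(** The swap moves the factor on which f acts to the right, where the skew
product lemma applies. *)
Lemma mp_prodl d1 d2 d3 (T1 : measurableType d1) (T2 : measurableType d2)
    (T3 : measurableType d3) (R : realType)
    (m1 : {sigma_finite_measure set T1 -> \bar R})
    (m2 : {sigma_finite_measure set T2 -> \bar R})
    (m3 : {sigma_finite_measure set T3 -> \bar R}) (f : T1 -> T2) :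
  mpreserving m1 m2 f ->
  mpreserving (sfprod m1 m3) (sfprod m2 m3) (fun z : T1 * T3 => (f z.1, z.2)).
Proof.
move=> fP.
have mid : mpreserving (sfprod m3 m1) (sfprod m3 m2) (fun z : T3 * T1 => (z.1, f z.2)).
  apply: (@mp_skew _ _ _ _ _ _ _ m3 m1 m2 (fun=> f)) => //.
  by apply: measurableT_comp; [case: fP|].
exact: mp_comp (mp_comp (mp_swap m1 m3) mid) (mp_swap m3 m2).
Qed.

Lemma mp_prod d1 d2 d3 d4 (T1 : measurableType d1) (T2 : measurableType d2)
    (T3 : measurableType d3) (T4 : measurableType d4) (R : realType)
    (m1 : {sigma_finite_measure set T1 -> \bar R})
    (m2 : {sigma_finite_measure set T2 -> \bar R})
    (m3 : {sigma_finite_measure set T3 -> \bar R})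
    (m4 : {sigma_finite_measure set T4 -> \bar R}) (f : T1 -> T3) (g : T2 -> T4) :
  mpreserving m1 m3 f -> mpreserving m2 m4 g ->
  mpreserving (sfprod m1 m2) (sfprod m3 m4) (fun z : T1 * T2 => (f z.1, g z.2)).
Proof.
move=> fP gP.
have skew : mpreserving (sfprod m1 m2) (sfprod m1 m4) (fun z : T1 * T2 => (z.1, g z.2)).
  apply: (@mp_skew _ _ _ _ _ _ _ m1 m2 m4 (fun=> g)) => //.
  by apply: measurableT_comp => //; case: gP.
exact: mp_comp skew (mp_prodl m4 fP).
Qed.

(** * Lebesgue measure on R^4 *)

Section Lebesgue.
Context {R : realType}.
Local Notation mR := (measurableTypeR R).
Local Notation mu := (@lebesgue_measure R).

Lemma mp_translation (c : R) : mpreserving mu mu (fun x : mR => (x : R) + c : mR).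
Proof.
have mt : measurable_fun setT (fun x : mR => (x : R) + c : mR).
  exact: measurable_funD.
split=> // S mS.
rewrite -[LHS]/(pushforward mu (fun x : mR => (x : R) + c : mR) S).
apply/esym/lebesgue_measure_unique => //= _ [[a b] _ <-]; rewrite /pushforward.
have -> : (fun x : R => x + c) @^-1` `]a, b]%classic = `]a - c, b - c]%classic.
  by apply/seteqP; split => x /=; rewrite !in_itv /= ltrBlDr lerBrDr.
rewrite !lebesgue_measure_itv /= !lte_fin ltrD2r.
by case: ifP => // _; rewrite -!EFinD; congr (_%:E); ring.
Qed.

(** In each fibre a shear is a translation. *)
Lemma mp_shear d (T : measurableType d)
    (m : {sigma_finite_measure set T -> \bar R}) (g : T -> R) :
  measurable_fun setT g ->
  mpreserving (sfprod m mu) (sfprod m mu)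
    (fun z : T * mR => (z.1, (z.2 : R) + g z.1 : mR)).
Proof.
move=> mg; apply: (@mp_skew _ _ _ _ _ _ _ m mu mu (fun x (y : mR) => (y : R) + g x : mR)).
  by apply: measurable_funD => //; exact: measurableT_comp.
by move=> x; exact: mp_translation.
Qed.

(** Parenthesized as in the definition of the volume of R^8, so that the latter
is a product of four further lines with this measure. *)
Definition vol4 := sfprod (sfprod (sfprod mu mu) mu) mu.

(** A shear acts on the last coordinate; conjugating by this rotation makes it
act on any other one. *)
Definition rot4 (z : mR * mR * mR * mR) : mR * mR * mR * mR :=
  let: (a, b, c, d) := z in (d, a, b, c).

Lemma mp_rot4 : mpreserving vol4 vol4 rot4.
Proof.
have -> : rot4 = (fun z => (assocl z.1, z.2)) \o @assocl _ _ _ mR (mR * mR)%type mR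
    \o (fun z : mR * mR * mR * mR => (z.2, z.1)).
  by apply/funext => -[[[a b] c] d].
have h1 := mp_swap (sfprod (sfprod mu mu) mu) mu.
have h2 := mp_assocl mu (sfprod mu mu) mu.
have h3 := mp_prodl mu (mp_assocl mu mu mu).
exact: mp_comp (mp_comp h1 h2) h3.
Qed.

Definition vec4 (z : mR * mR * mR * mR) : 'cV[R]_4 :=
  let: (a, b, c, d) := z in \col_(i < 4) [:: a : R; b : R; c : R; d : R]`_i.

Definition pt4 (u : 'cV[R]_4) : mR * mR * mR * mR :=
  (u (inord 0) 0, u (inord 1) 0, u (inord 2) 0, u (inord 3) 0).

Lemma pt4K : cancel pt4 vec4.
Proof.
move=> u; apply/colP => i; rewrite mxE.
by case: i => [[|[|[|[|//]]]] hi] /=; congr (u _ _); apply/val_inj; rewrite /= ?inordK.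
Qed.

Lemma vec4K : cancel vec4 pt4.
Proof. by move=> [[[a b] c] d]; rewrite /pt4 !mxE !inordK. Qed.

Definition lin4 (M : 'M[R]_4) z := pt4 (M *m vec4 z).

Lemma lin4M M N z : lin4 (M *m N) z = lin4 M (lin4 N z).
Proof. by rewrite /lin4 pt4K mulmxA. Qed.

Lemma measurable_vec4 (j : 'I_4) : measurable_fun setT (fun z => vec4 z j 0 : mR).
Proof.
rewrite (_ : (fun z => _) = fun z => [:: z.1.1.1 : R; z.1.1.2 : R; z.1.2 : R; z.2 : R]`_j).
  by case: j => [[|[|[|[|//]]]] hj] /=; do ?apply: measurableT_comp.
by apply/funext => -[[[a b] c] d]; rewrite mxE.
Qed.

(** The transvection adds c times coordinate j to coordinate i. Rotating 3 - i
times brings coordinate i to the last place, and i.+1 further rotations restore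
the order. *)
Lemma mp_lin4_transvection (i j : 'I_4) c : i != j ->
  mpreserving vol4 vol4 (lin4 (1%:M + c *: delta_mx i j)).
Proof.
move=> ij.
(* coordinate j, read off after restoring the order; the placeholder 0 then
   occupies place i, which differs from j *)
pose g (p : mR * mR * mR) : R := c * vec4 (iter i.+1 rot4 (p, 0 : mR)) j 0.
have iter_mp m : mpreserving vol4 vol4 (iter m rot4).
  elim: m => [|m IH]; first exact: mp_id.
  exact: mp_comp IH mp_rot4.
have mg : measurable_fun setT g.
  apply: measurable_funM => //.
  apply: (measurableT_comp (measurable_vec4 j)).
  by apply: measurableT_comp; [exact: (iter_mp _).1|exact: measurable_fun_pair].
have shear := mp_shear (sfprod (sfprod mu mu) mu) mg.
have := mp_comp (mp_comp (iter_mp (3 - i)%N) shear) (iter_mp i.+1).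
rewrite (_ : _ \o _ = lin4 (1%:M + c *: delta_mx i j)) //.
apply/funext => -[[[x y] z] w]; rewrite /lin4 mul_transvection_col /g.
case: i j ij {g mg shear} => [[|[|[|[|//]]]] hi] [[|[|[|[|//]]]] hj] ij //=;
  rewrite /pt4 !mxE -!val_eqE /= !inordK //=; rewrite ?(mulr0, mulr1, addr0) //=.
Qed.

End Lebesgue.

(** * Measurability *)

(** The topology is given by its neighbourhood filters nb, so that the measurable
and the topological structure may live on different presentations of the same
type. *)
Definition measurable_basis d (T : measurableType d) (nb : T -> set_system T) :=
  exists2 B : nat -> set T, forall n, measurable (B n) &
    forall x N, nb x N -> exists2 n, B n x & B n `<=` N.

Lemma measurable_basis_open d (T : measurableType d) (nb : T -> set_system T)
    (O : set T) :
  measurable_basis nb -> (forall x, O x -> nb x O) -> measurable O.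
Proof.
move=> [B mB basis] openO.
rewrite (_ : O = \bigcup_(n in [set n | B n `<=` O]) B n).
  exact: bigcup_measurable.
apply/seteqP; split => [x Ox|x [n BO /BO//]].
by have [n Bx BO] := basis _ _ (openO x Ox); exists n.
Qed.

(** Meant for R^8, where nb is the iterated product of the neighbourhood filters of
the factors and membership in nb x expresses openness. *)
Lemma mp_open d (T : measurableType d) (R : realType) (nb : T -> set_system T)
    (m : {sigma_finite_measure set T -> \bar R}) (f : T -> T) (O : set T) :
  measurable_basis nb -> mpreserving m m f -> (forall x, O x -> nb x O) ->
  m (f @^-1` O) = m O.
Proof.
move=> basis [_ fP] openO; rewrite fP //; exact: measurable_basis_open openO.
Qed.

(** Boxes of basic sets, enumerated through the pairing of indices. *)
Lemma measurable_basis_prod d1 d2 (T1 : measurableType d1) (T2 : measurableType d2)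
    (nb1 : T1 -> set_system T1) (nb2 : T2 -> set_system T2) :
  measurable_basis nb1 -> measurable_basis nb2 ->
  measurable_basis (fun z : T1 * T2 => filter_prod (nb1 z.1) (nb2 z.2)).
Proof.
move=> [B1 mB1 basis1] [B2 mB2 basis2].
exists (fun n => if unpickle n is Some ij then B1 ij.1 `*` B2 ij.2 else set0).
  by move=> n; case: unpickle => [ij|]; [exact: measurableX|exact: measurable0].
move=> [x y] N [[N1 N2] /= [/basis1[i Bx B1N] /basis2[j By B2N]] sub].
exists (pickle (i, j)); rewrite pickleK //= => -[x' y'] /= [/B1N ? /B2N ?].
exact: sub.
Qed.

Lemma measurable_basis_R (R : realType) :
  measurable_basis (fun x : measurableTypeR R => nbhs (x : R)).
Proof.
exists (fun n => if unpickle n is Some pq then `](ratr pq.1 : R), ratr pq.2[%classic else set0).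
  by move=> n; case: unpickle => [ij|]; [exact: measurable_itv|exact: measurable0].
move=> x N /nbhs_ballP[e /= e0 xeN].
have [|p] := @rat_in_itvoo _ (x - e) x; first by rewrite ltrBlDr ltrDl.
have [|q] := @rat_in_itvoo _ x (x + e); first by rewrite ltrDl.
rewrite !in_itv /= => /andP[xq qe] /andP[ep px].
exists (pickle (p, q)); rewrite pickleK /= ?in_itv /= ?px // => y.
rewrite /= in_itv /= => /andP[py yq]; apply: xeN; rewrite /ball /= ltr_distlC.
by rewrite (lt_trans ep py) (lt_trans yq qe).
Qed.

Section ContinuousOnR3.
Context {R : realType}.
Local Notation mR := (measurableTypeR R).

Lemma continuous_measurable3 (f : R * R * R -> R) : continuous f ->
  measurable_fun setT (f : mR * mR * mR -> R).
Proof.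
move=> cf; apply: (measurability _ (RGenOInfty.measurableE R)) => //.
move=> _ [_ [a ->] <-]; rewrite setTI.
have b := @measurable_basis_R R.
apply: (measurable_basis_open (measurable_basis_prod (measurable_basis_prod b b) b)).
move=> x fx; apply: cf; apply: open_nbhs_nbhs; split => //; exact: interval_open.
Qed.

End ContinuousOnR3.

Section MeasurableExp.
Context d (T : measurableType d) (R : realType) (n : nat).
Variable M : T -> 'M[R]_n.+1.
Hypothesis mM : forall i j, measurable_fun setT (fun z => M z i j).

Lemma measurable_mx_expr k i j : measurable_fun setT (fun z => (M z ^+ k) i j).
Proof.
elim: k i j => [|k IH] i j.
  by under eq_fun do rewrite expr0; exact: measurable_cst.
under eq_fun do rewrite exprS mxE.
by apply: measurable_sum => l; exact: measurable_funM.
Qed.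

Lemma measurable_expmx i j : measurable_fun setT (fun z => expmx (M z) i j).
Proof.
apply: (@measurable_fun_cvg _ _ _ _ (fun N z => exp_sum N (M z) i j)).
  move=> N; rewrite /exp_sum; under eq_fun do rewrite summxE.
  apply: measurable_sum => k; under eq_fun do rewrite mxE.
  by apply: measurable_funM => //; exact: measurable_mx_expr.
by move=> z _; have /cvg_mxP := @cvg_expmx _ _ (M z); exact.
Qed.
End MeasurableExp.

Section FieldMeasurability.
Context {R : realType}.
Variables (A : 'cV[R]_3 -> 'cV[R]_3) (U : 'cV[R]_3 -> R).
Hypotheses (hA : smooth A) (hU : smooth U).
Local Notation mR := (measurableTypeR R).

Lemma continuous_vec3 : continuous (fun p : R * R * R => vec3 p.1.1 p.1.2 p.2).
Proof.
move=> p; apply/cvg_mxP => i j; under eq_fun do rewrite mxE; rewrite mxE.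
case: i => [[|[|[|//]]] hi] /=.
- by apply: continuous_comp; exact: cvg_fst.
- by apply: (@continuous_comp _ _ _ fst snd); [exact: cvg_fst|exact: cvg_snd].
- exact: cvg_snd.
Qed.

Lemma electric_continuous i : continuous (fun x => electric U x i 0).
Proof.
rewrite (_ : (fun x => _) = (fun x => - partial i U x)); last first.
  by apply/funext => x; rewrite !mxE.
by move=> x; apply: continuousN; exact: ((hU [:: i]).1 x).
Qed.

(** The curl differentiates the components of A, while smoothness speaks of the
partial derivatives of the vector-valued A. *)
Lemma curl_term_continuous (j k : 'I_3) :
  continuous (fun x => partial j (fun y => A y k 0) x).
Proof.
rewrite (_ : partial j _ = (fun x => partial j A x k 0)); last first.
  by apply/funext => x; rewrite /partial derive_mx ?mxE //; exact: ((hA [::]).2 j x).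
move=> x; apply: (@continuous_comp _ _ _ (partial j A) (fun M : 'cV[R]_3 => M k 0)).
  exact: ((hA [:: j]).1 x).
exact: coord_continuous.
Qed.

Lemma magnetic_continuous i : continuous (fun x => magnetic A x i 0).
Proof.
by case: (ord3P i) => ->; under eq_fun do rewrite mxE inordK //=;
  move=> x; apply: continuousB; exact: curl_term_continuous.
Qed.

(** The action of the force matrix on the real coordinates (v, gamma), where w =
i gamma. *)
Definition real_force (x : 'cV[R]_3) : 'M[R]_(3 + 1) :=
  block_mx (Btilde A x) (electric U x) (electric U x)^T 0.

Lemma measurable_real_force i j :
  measurable_fun setT (fun p : mR * mR * mR =>
    real_force (vec3 (p.1.1 : R) (p.1.2 : R) (p.2 : R)) i j).
Proof.
have along (f : 'cV[R]_3 -> R) : continuous f -> measurable_fun setT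
    (fun p : mR * mR * mR => f (vec3 (p.1.1 : R) (p.1.2 : R) (p.2 : R))).
  move=> cf; apply: (@continuous_measurable3 R (fun p => f (vec3 p.1.1 p.1.2 p.2))).
  by move=> p; apply: (continuous_comp (continuous_vec3 (x := p))); exact: cf.
have mB k := along _ (@magnetic_continuous k).
have mE k := along _ (@electric_continuous k).
rewrite /real_force.
case: (split_ordP i) => i' ->; case: (split_ordP j) => j' ->.
- under eq_fun do rewrite block_mxEul mxE mxE.
  by case: (ord3P i') => ->; rewrite inordK //=; apply: measurable_funB;
    apply: measurable_funM => //; exact: mB.
- by rewrite (ord1 j'); under eq_fun do rewrite block_mxEur; exact: (mE i').
- by rewrite (ord1 i'); under eq_fun do rewrite block_mxEdl mxE; exact: (mE j').
- by under eq_fun do rewrite block_mxEdr mxE; exact: measurable_cst.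
Qed.

End FieldMeasurability.

(** * The flow in real coordinates *)

Section Flow.
Context {R : realType}.
Variables (A : 'cV[R]_3 -> 'cV[R]_3) (U : 'cV[R]_3 -> R).
Local Notation mR := (measurableTypeR R).
Local Notation mu := (@lebesgue_measure R).
Local Notation R4 := (mR * mR * mR * mR)%type.
Local Notation vol4 := (@vol4 R).

Lemma mp_lin4 (M : 'M[R]_4) : \det M = 1 -> mpreserving vol4 vol4 (lin4 M).
Proof.
move: M; apply: transvection_ind.
- rewrite (_ : lin4 _ = id); first exact: mp_id.
  by apply/funext => z; rewrite /lin4 mul1mx vec4K.
- move=> M N PM PN; rewrite (_ : lin4 _ = lin4 M \o lin4 N); first exact: mp_comp PN PM.
  by apply/funext => z; rewrite lin4M.
- exact: mp_lin4_transvection.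
Qed.

Definition shift4 (h : R) (q p : R4) : R4 :=
  ((p.1.1.1 : R) + h * q.1.1.1, (p.1.1.2 : R) + h * q.1.1.2,
   (p.1.2 : R) + h * q.1.2, (p.2 : R) + h * q.2).

Lemma mp_shift4 h q : mpreserving vol4 vol4 (shift4 h q).
Proof.
have t c := @mp_translation R c.
exact: (mp_prod (mp_prod (mp_prod (t _) (t _)) (t _)) (t _)).
Qed.

Definition pos (p : R4) : 'cV[R]_3 := vec3 (p.1.1.1 : R) (p.1.1.2 : R) (p.1.2 : R).

Definition kick_mx (a : R) (p : R4) : 'M[R]_4 := expmx (a *: real_force A U (pos p)).

(** The Lorentz metric: the force is an infinitesimal isometry of it. *)
Definition minkowski : 'M[R]_(3 + 1) := block_mx 1%:M 0 0 (-1)%:M.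

Lemma minkowskiK : minkowski *m minkowski = 1%:M.
Proof.
rewrite mulmx_block !(mul1mx, mulmx1, mul0mx, mulmx0, addr0, add0r).
by rewrite -scalar_mxM mulrNN mulr1 -scalar_mx_block.
Qed.

Lemma real_force_tr x :
  (real_force A U x)^T = minkowski *m - real_force A U x *m minkowski.
Proof.
rewrite /real_force tr_block_mx trmxK trmx0 Btilde_skew opp_block_mx !mulmx_block.
rewrite !(mul1mx, mulmx1, mul0mx, mulmx0, addr0, add0r, oppr0).
by rewrite !(mul_scalar_mx, mul_mx_scalar) !scaleN1r !opprK.
Qed.

Lemma kick_mx_det a p : \det (kick_mx a p) = 1.
Proof.
apply: (@det_expmx_skew _ _ minkowski minkowski); first exact: minkowskiK.
rewrite linearZ /= real_force_tr -scalerN.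
by rewrite -[RHS]/(minkowski *m (a *: _) *m minkowski) -scalemxAr -scalemxAl.
Qed.

Lemma kick_mxK a p : kick_mx (- a) p *m kick_mx a p = 1%:M.
Proof. by rewrite /kick_mx scaleNr; exact: expmxNK. Qed.

Definition kick a (z : R4 * R4) : R4 * R4 := (z.1, lin4 (kick_mx a z.1) z.2).
Definition drift h (z : R4 * R4) : R4 * R4 := (shift4 h z.2 z.1, z.2).
Definition flow h : R4 * R4 -> R4 * R4 := kick (h / 2) \o drift h \o kick (h / 2).

Lemma kickK a : cancel (kick a) (kick (- a)).
Proof. by move=> [p q]; rewrite /kick /= -lin4M kick_mxK /lin4 mul1mx vec4K. Qed.

Lemma driftK h : cancel (drift h) (drift (- h)).
Proof.
by move=> [[[[a b] c] d] q]; rewrite /drift /shift4 /= !mulNr !addrK.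
Qed.

Lemma flowK h : cancel (flow h) (flow (- h)).
Proof. by move=> z; rewrite /flow /= mulNr kickK driftK kickK. Qed.

Lemma flowNK h : cancel (flow (- h)) (flow h).
Proof. by move=> z; rewrite -{1}(opprK h) flowK. Qed.

Section FlowPreservesVolume.
Hypotheses (hA : smooth A) (hU : smooth U).

Lemma measurable_kick_mx a i j : measurable_fun setT (fun p : R4 => kick_mx a p i j).
Proof.
apply: measurable_expmx => k l; under eq_fun do rewrite mxE.
apply: measurable_funM => //.
apply: (measurableT_comp (measurable_real_force hA hU k l) measurable_fst).
Qed.

Lemma measurable_kick a :
  measurable_fun setT (fun z : R4 * R4 => lin4 (kick_mx a z.1) z.2).
Proof.
have entry i : measurable_fun setT
    (fun z : R4 * R4 => (kick_mx a z.1 *m vec4 z.2) i 0 : mR).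
  under eq_fun do rewrite mxE.
  apply: measurable_sum => k; apply: measurable_funM.
    by apply: (measurableT_comp (measurable_kick_mx a i k)).
  by apply: (measurableT_comp (measurable_vec4 k)).
by rewrite /lin4 /pt4; do ?apply: measurable_fun_pair; exact: entry.
Qed.

Lemma mp_kick a : mpreserving (sfprod vol4 vol4) (sfprod vol4 vol4) (kick a).
Proof.
apply: (@mp_skew _ _ _ _ _ _ _ vol4 vol4 vol4 (fun p q => lin4 (kick_mx a p) q)).
  exact: measurable_kick.
by move=> p; apply: mp_lin4; exact: kick_mx_det.
Qed.

Lemma measurable_shift h :
  measurable_fun setT (fun z : R4 * R4 => shift4 h z.1 z.2).
Proof.
have mq (f : R4 -> R) : measurable_fun setT (f : R4 -> mR) ->
    measurable_fun setT (fun z : R4 * R4 => f z.2 + h * f z.1 : mR).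
  move=> mf; apply: measurable_funD; first exact: (measurableT_comp mf).
  by apply: measurable_funM => //; exact: (measurableT_comp mf).
rewrite /shift4; do ?apply: measurable_fun_pair.
- by apply: (mq (fun q => q.1.1.1)); do ?apply: measurableT_comp.
- by apply: (mq (fun q => q.1.1.2)); do ?apply: measurableT_comp.
- by apply: (mq (fun q => q.1.2)); do ?apply: measurableT_comp.
- by apply: (mq (fun q => q.2)); exact: measurable_snd.
Qed.

Lemma mp_drift h : mpreserving (sfprod vol4 vol4) (sfprod vol4 vol4) (drift h).
Proof.
have skew := mp_skew vol4 (measurable_shift h) (mp_shift4 h).
exact: mp_comp (mp_comp (mp_swap vol4 vol4) skew) (mp_swap vol4 vol4).
Qed.

Lemma mp_flow h : mpreserving (sfprod vol4 vol4) (sfprod vol4 vol4) (flow h).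
Proof. exact: mp_comp (mp_kick _) (mp_comp (mp_drift h) (mp_kick _)). Qed.

End FlowPreservesVolume.

(** * Complex states *)

(** The change of variables t = i tbar, w = i gamma, which pulls the
standard bilinear form, for which the force is skew-symmetric, back to the
Lorentz metric. *)
Definition wick : 'M[R[i]]_(3 + 1) := block_mx 1%:M 0 0 'i%C%:M.
Definition wick_inv : 'M[R[i]]_(3 + 1) := block_mx 1%:M 0 0 (- 'i%C)%:M.

Lemma wickK : wick_inv *m wick = 1%:M.
Proof.
rewrite mulmx_block !(mul1mx, mulmx1, mul0mx, mulmx0, addr0, add0r).
by rewrite -scalar_mxM mulNr -expr2 sqr_i opprK -scalar_mx_block.
Qed.

Lemma force_wick x : force A U x = wick *m cplx (real_force A U x) *m wick_inv.
Proof.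
rewrite /force /real_force /cplx map_block_mx !mulmx_block map_mx0.
rewrite !(mul1mx, mulmx1, mul0mx, mulmx0, addr0, add0r).
by rewrite mul_mx_scalar mul_scalar_mx map_trmx.
Qed.

Lemma vec4E (p : R4) : vec4 p = col_mx (pos p) (p.2 : R)%:M :> 'cV[R]_(3 + 1).
Proof.
case: p => [[[a b] c] d]; apply/colP => i; rewrite mxE.
case: (split_ordP i) => j ->; rewrite ?col_mxEu ?col_mxEd ?mxE ?ord1 /=.
  by case: j => [[|[|[|//]]] hj].
by rewrite mulr1n.
Qed.

Lemma wick_vec4 (p : R4) : wick *m cplx (vec4 p : 'cV[R]_(3 + 1)) =
  col_mx (cplx (pos p)) ('i%C * (p.2 : R)%:C%C)%:M.
Proof.
have -> : cplx (vec4 p : 'cV[R]_(3 + 1)) = col_mx (cplx (pos p)) ((p.2 : R)%:C%C)%:M.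
  by rewrite -[X in col_mx _ X]map_scalar_mx -map_col_mx -vec4E.
by rewrite mul_block_col !(mul1mx, mul0mx) addr0 add0r -scalar_mxM.
Qed.

Definition real_state (z : R4 * R4) : state :=
  (wick *m cplx (vec4 z.1), wick *m cplx (vec4 z.2)).

Lemma real_state_inj : injective real_state.
Proof.
have inj : injective (fun p : R4 => wick *m cplx (vec4 p : 'cV[R]_(3 + 1))).
  move=> p q /(congr1 (mulmx wick_inv)); rewrite !mulmxA wickK !mul1mx.
  move=> e; apply: (can_inj vec4K); apply/colP => i.
  by have := congr1 (fun M : 'cV[R[i]]_(3 + 1) => M i 0) e; rewrite !mxE => -[].
by move=> [p q] [p' q'] [/inj /= -> /inj /= ->].
Qed.

Lemma space_real_state z : space (real_state z) = pos z.1.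
Proof.
by rewrite /space /real_state wick_vec4 col_mxKu; apply/matrixP => i j; rewrite !mxE.
Qed.

Lemma Psi1_real_state a z : Psi1 A U a (real_state z) = real_state (kick a z).
Proof.
rewrite /Psi1 space_real_state; congr (_, _).
rewrite -[RHS]/(wick *m cplx (vec4 (lin4 (kick_mx a z.1) z.2))).
have -> : a%:C%C *: force A U (pos z.1) =
    wick *m cplx (a *: real_force A U (pos z.1)) *m wick_inv.
  by rewrite force_wick /cplx map_mxZ /= -scalemxAr -scalemxAl.
rewrite (expmx_complex (a *: real_force A U (pos z.1)) wickK).
rewrite -[X in X *m _ = _]/(wick *m cplx (kick_mx a z.1) *m wick_inv) /lin4 pt4K.
by rewrite /cplx map_mxM /= -!mulmxA (mulmxA wick_inv) wickK mul1mx.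
Qed.

Lemma Psi2_real_state h z : Psi2 h (real_state z) = real_state (drift h z).
Proof.
rewrite /Psi2 /real_state /drift /=; congr (_, _).
rewrite scalemxAr -mulmxDr; congr (_ *m _).
case: z => [[[[a b] c] d] [[[a' b'] c'] d']]; apply/colP => i; rewrite !mxE /=.
by case: i => [[|[|[|[|//]]]] hi] /=; rewrite rmorphD rmorphM.
Qed.

Lemma Psi_real_state h z : Psi A U h (real_state z) = real_state (flow h z).
Proof. by rewrite /Psi /= Psi1_real_state Psi2_real_state Psi1_real_state. Qed.

(** Separates positions from velocities. *)
Definition split8 (z : R8 R) : R4 * R4 :=
  let: (x1, x2, x3, t, v1, v2, v3, g) := z in ((x1, x2, x3, t), (v1, v2, v3, g)).
Definition join8 (z : R4 * R4) : R8 R :=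
  let: (p, (v1, v2, v3, g)) := z in (p, v1, v2, v3, g).

Lemma split8K : cancel split8 join8.
Proof. by move=> [[[[[[[x1 x2] x3] t] v1] v2] v3] g]. Qed.

Lemma join8K : cancel join8 split8.
Proof. by move=> [[[[a b] c] d] [[[a' b'] c'] d']]. Qed.

Lemma complex_coordsE z : complex_coords z = real_state (split8 z).
Proof.
case: z => [[[[[[[x1 x2] x3] t] v1] v2] v3] g] /=.
by rewrite /real_state !wick_vec4.
Qed.

Definition vol8 := sfprod (sfprod (sfprod (sfprod vol4 mu) mu) mu) mu.

Lemma volE : vol = vol8 :> (set (R8 R) -> \bar R).
Proof. by []. Qed.

Lemma mp_split8 : mpreserving vol8 (sfprod vol4 vol4) split8.
Proof.
have h1 := mp_prodl mu (mp_prodl mu (mp_assocr vol4 mu mu)).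
have h2 := mp_prodl mu (mp_assocr vol4 (sfprod mu mu) mu).
have h3 := mp_assocr vol4 (sfprod (sfprod mu mu) mu) mu.
have := mp_comp h1 (mp_comp h2 h3).
rewrite (_ : _ \o _ = split8) //.
by apply/funext => -[[[[[[[x1 x2] x3] t] v1] v2] v3] g].
Qed.

Lemma mp_join8 : mpreserving (sfprod vol4 vol4) vol8 join8.
Proof.
have h1 := mp_prodl mu (mp_prodl mu (mp_assocl vol4 mu mu)).
have h2 := mp_prodl mu (mp_assocl vol4 (sfprod mu mu) mu).
have h3 := mp_assocl vol4 (sfprod (sfprod mu mu) mu) mu.
have := mp_comp (mp_comp h3 h2) h1.
rewrite (_ : _ \o _ = join8) //.
by apply/funext => -[p [[[v1 v2] v3] g]].
Qed.

(** Images under an invertible map are preimages under its inverse, here the flow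
with the opposite step. *)
Lemma Psi_image h (O : set (R8 R)) :
  complex_coords @^-1` (Psi A U h @` (complex_coords @` O)) =
  (join8 \o flow (- h) \o split8) @^-1` O.
Proof.
apply/seteqP; split => z; last first.
  move=> Oz; exists (complex_coords (join8 (flow (- h) (split8 z)))).
    by exists (join8 (flow (- h) (split8 z))).
  by rewrite !complex_coordsE join8K Psi_real_state flowNK.
move=> [_ [w Ow <-]]; rewrite !complex_coordsE Psi_real_state => /real_state_inj zw.
by change (O (join8 (flow (- h) (split8 z)))); rewrite -zw flowK split8K.
Qed.

End Flow.

Theorem theorem4 (R : realType) (A : 'cV[R]_3 -> 'cV[R]_3) (U : 'cV[R]_3 -> R)
    (hA : smooth A) (hU : smooth U) (h : R)
    (Omega : set (R8 R))
    (openOmega : open Omega) (boundedOmega : bounded_set Omega) :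
  vol (complex_coords @^-1` (Psi A U h @` (complex_coords @` Omega))) = vol Omega.
Proof.
rewrite Psi_image volE.
have preserved := mp_comp (mp_split8 (R := R))
  (mp_comp (mp_flow hA hU (- h)) (mp_join8 (R := R))).
have b := @measurable_basis_R R.
have b8 := measurable_basis_prod (measurable_basis_prod (measurable_basis_prod
  (measurable_basis_prod (measurable_basis_prod (measurable_basis_prod
  (measurable_basis_prod b b) b) b) b) b) b) b.
rewrite openE in openOmega.
exact: (mp_open b8 preserved openOmega).
Qed.
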